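(* Let $\mathcal H$ be a Hilbert space, let $\mathcal S$ and $\mathcal T$ be closed subspaces of $\mathcal H$, and let $P_{\mathcal S}$, $P_{\mathcal T}$ be the orthogonal projections onto them. Then $P_{\mathcal S}P_{\mathcal T}$ is compact if and only if there exist orthonormal bases $\{\xi_n: n\ge 1\}$ and $\{\psi_n: n\ge 1\}$ of $\mathcal S$ and $\mathcal T$, respectively, such that $\langle \xi_n,\psi_k\rangle=0$ if $n\neq k$ and $\langle\xi_n,\psi_n\rangle\to 0$ as $n\to\infty$.
   Context: ''Orthonormal basis'' is meant in the Hilbert space sense (a complete orthonormal system).
   Formalization: The two bases are indexed by possibly different subsets of a common index set, since indexing both by all n ≥ 1 can be impossible; the limit runs over common indices. Arbitrary index sets are allowed in general; sequences indexed by naturals are used when S and T are separable. *)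

(* Defs.v *)
From HB Require Import structures.
From mathcomp Require Import all_boot all_order all_algebra.
From mathcomp Require Import all_classical all_reals all_analysis.
From mathcomp Require Import complex.
Set Implicit Arguments.
Unset Strict Implicit.
Unset Printing Implicit Defensive.
Import Order.TTheory GRing.Theory Num.Theory numFieldNormedType.Exports.
Local Open Scope classical_set_scope.
Local Open Scope ring_scope.

(* A Hilbert space is a complex Banach space [H] together with an inner product
   [dot], linear in its first argument, such that [induces_norm dot]. *)
Definition induces_norm (R : realType) (H : completeNormedModType R[i])
    (dot : {dot H for @Num.conj R[i]}) :=
  forall x : H, `|x| ^+ 2 = dot x x.

Definition closed_subspace (R : realType) (H : completeNormedModType R[i])
    (S : set H) :=
  [/\ S 0,
      forall (a : R[i]) (x y : H), S x -> S y -> S (a *: x + y)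
    & closed S].

Definition orthogonal_projection (R : realType)
    (H : completeNormedModType R[i]) (dot : {dot H for @Num.conj R[i]})
    (S : set H) (P : H -> H) :=
  forall x : H, S (P x) /\ forall y : H, S y -> dot (x - P x) y = 0.

Definition compact_operator (R : realType) (H : completeNormedModType R[i])
    (f : H -> H) :=
  linear f /\ forall A : set H, bounded_set A -> precompact (f @` A).

Definition separable_set (R : realType) (H : completeNormedModType R[i])
    (S : set H) :=
  exists D : set H, [/\ countable D, D `<=` S & S `<=` closure D].

Definition cofinite (I : Type) : set_system I := [set U | cofinite_set U].

(* The family [e], restricted to the index set [A], is a complete orthonormal
   system of [S]; the values of [e] outside [A] are irrelevant. *)
Definition orthonormal_basis (R : realType) (H : completeNormedModType R[i])
    (dot : {dot H for @Num.conj R[i]}) (S : set H)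
    (I : Type) (A : set I) (e : I -> H) :=
  [/\ forall n, A n -> S (e n),
      forall n, A n -> dot (e n) (e n) = 1,
      forall n k, A n -> A k -> n <> k -> dot (e n) (e k) = 0
    & forall x, S x -> (forall n, A n -> dot x (e n) = 0) -> x = 0].

(* Bases [{xi n : n in A}] of [S] and [{psi n : n in B}] of [T], labelled by
   subsets of a common index type. The dimensions of [S] and [T] may differ, and
   [A = B] may be impossible even when they do not: if [S] is the closed span
   of [e 1, e 2, ...] and [T] that of [e 0] and the vectors [e n + n *: f n]
   ([n >= 1], all the [e n] and [f n] orthonormal), then no pair of bases as
   required has [A = B].
   [F] is the filter along which the index tends to infinity: [\oo] for
   sequences, [cofinite I] for families with an arbitrary index type. *)
Definition has_diagonal_bases (R : realType) (H : completeNormedModType R[i])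
    (dot : {dot H for @Num.conj R[i]}) (S T : set H)
    (I : Type) (F : set_system I) :=
  exists (A B : set I) (xi psi : I -> H),
    [/\ orthonormal_basis dot S A xi,
        orthonormal_basis dot T B psi,
        forall n k, A n -> B k -> n <> k -> dot (xi n) (psi k) = 0
      & (fun n => dot (xi n) (psi n) : R[i]^o) @ within (A `&` B) F
          --> (0 : R[i]^o)].

(* Main.v *)
(* Compactness gives the bases by a maximality argument that avoids the spectral
   theorem. Call a pair of unit vectors x of S and y of T singular if P_S y is a
   multiple of x, P_T x is a multiple of y and <x, y> <> 0; take a maximal family
   of singular pairs, orthogonal in both components. On the part of T orthogonal
   to the family P_S vanishes, for otherwise a vector of maximal norm in the
   closure of the image of the unit ball yields one more pair; so what is left of
   S and of T may be completed by arbitrary orthonormal systems. The products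
   <x, y> tend to 0 since the vectors P_S y are orthogonal in a precompact set.
   Conversely, diagonal bases give P_S psi_n = <psi_n, xi_n> xi_n, so P_S P_T is
   a uniform limit on bounded sets of maps with values in compact sets. *)
Require Import Defs.
From HB Require Import structures.
From mathcomp Require Import all_boot all_order all_algebra finmap.
From mathcomp Require Import all_classical all_reals all_analysis.
From mathcomp Require Import complex ring lra.
Set Implicit Arguments.
Unset Strict Implicit.
Unset Printing Implicit Defensive.
Import Order.TTheory GRing.Theory Num.Theory numFieldNormedType.Exports.
Local Open Scope classical_set_scope.
Local Open Scope ring_scope.

(** * Inner product algebra, Cauchy-Schwarz and Pythagoras *)

Section InnerProduct.
Variables (R : realType) (H : completeNormedModType R[i]).
Variables (dot : {dot H for @Num.conj R[i]}) (dot_norm : induces_norm dot).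
Implicit Types (x y z : H) (a : R[i]).

Lemma dotC x y : dot x y = (dot y x)^*.
Proof. by rewrite (hermC dot) expr0 mul1r. Qed.

Lemma dotZl a x y : dot (a *: x) y = a * dot x y.
Proof. exact: linearZl_LR. Qed.

Lemma dotZr a x y : dot x (a *: y) = a^* * dot x y.
Proof. exact: linearZr_LR. Qed.

Lemma dotDl x y z : dot (x + y) z = dot x z + dot y z.
Proof. exact: linearDl. Qed.

Lemma dotDr x y z : dot z (x + y) = dot z x + dot z y.
Proof. exact: linearDr. Qed.

Lemma dotBl x y z : dot (x - y) z = dot x z - dot y z.
Proof. exact: linearBl. Qed.

Lemma dotBr x y z : dot z (x - y) = dot z x - dot z y.
Proof. exact: linearBr. Qed.

Lemma dot_sumr x (I : Type) (s : seq I) (P : pred I) (f : I -> H) :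
  dot x (\sum_(i <- s | P i) f i) = \sum_(i <- s | P i) dot x (f i).
Proof. exact: linear_sumr. Qed.

Lemma dot_eq0C x y : dot x y = 0 -> dot y x = 0.
Proof. by move=> xy0; rewrite dotC xy0 conjC0. Qed.

Lemma cauchy_schwarz x y : `|dot x y| <= `|x| * `|y|.
Proof.
have [->|y0] := eqVneq y 0; first by rewrite linear0r !normr0 mulr0.
have ny : 0 < `|y| by rewrite normr_gt0.
have yy : dot y y != 0 by rewrite -dot_norm expf_neq0 ?gt_eqF.
(* [p] is the part of [x] orthogonal to [y]; expanding [0 <= dot p p] gives the inequality. *)
set p := x - (dot x y / dot y y) *: y.
have py : dot p y = 0 by rewrite dotBl dotZl divfK // subrr.
have : 0 <= dot p p by rewrite -dot_norm exprn_ge0.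
rewrite {2}/p dotBr dotZr py mulr0 subr0 dotBl dotZl.
rewrite (dotC y x) mulrAC -normCK -!dot_norm subr_ge0.
by rewrite ler_pdivrMr ?exprn_gt0// -exprMn ler_sqr ?nnegrE ?mulr_ge0.
Qed.

Lemma pythagoras x y : dot x y = 0 -> `|x + y| ^+ 2 = `|x| ^+ 2 + `|y| ^+ 2.
Proof. by move=> xy0; rewrite !dot_norm (hnormDd xy0). Qed.

End InnerProduct.

(** * Compact and precompact sets in a complex Banach space *)

Section NormedTopology.
Variables (R : realType) (H : completeNormedModType R[i]).
Implicit Types (X A B : set H) (x y : H) (e : R[i]).

Lemma closure_normP X x :
  closure X x <-> forall e, 0 < e -> exists2 y, X y & `|x - y| < e.
Proof.
split=> [clX e e0|clX B /nbhs_normP[e /= e0 eB]].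
  have [y [Xy xy]] := clX _ (nbhsx_ballx x e e0).
  by exists y; rewrite // -ball_normE in xy.
by have [y Xy xy] := clX e e0; exists y; split=> //; exact: eB.
Qed.

(* An ultrafilter on [X] follows, within [e], its image under a selection of
   nearby points of a compact set, which clusters; hence it is Cauchy. *)
Lemma precompact_approx X :
    (forall e, 0 < e -> exists2 C : set H, compact C &
       forall x, X x -> exists2 c, C c & `|x - c| < e) ->
  precompact X.
Proof.
move=> Xapprox; rewrite precompactE compact_ultra => F FU FX.
have FF : ProperFilter F by exact: ultra_proper.
suff : cauchy F.
  move=> /cauchy_cvg/cvg_ex[p Fp]; exists p; split => //.
  rewrite [closure X](closure_id _).1; last exact: closed_closure.
  by rewrite closureEcvg; exists F => //; split => // B XB; exact: filterS FX.
apply: cauchy_exP => e e0.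
have e30 : 0 < e / 3 by rewrite divr_gt0.
have [C cC XC] := Xapprox _ e30.
(* One third of [e] leads from the closure into [X], another from [X] into [C]; off the closure the
   value 0 is a placeholder. *)
have near_C x : exists c, closure X x -> C c /\ `|x - c| < e / 3 + e / 3.
  have [clx|nclx] := pselect (closure X x); last by exists 0.
  have [y Xy xy] := (closure_normP X x).1 clx _ e30.
  have [c Cc yc] := XC _ Xy; exists c => _; split=> //.
  by rewrite -[x](subrK y) -addrA (le_lt_trans (ler_normD _ _))// ltrD.
have [c cP] := choice near_C.
have [p [Cp clp]] : C `&` cluster (c @ F) !=set0.
  by apply: cC; rewrite /fmap/=; apply: filterS FX => x /cP[].
(* Otherwise the complement of the ball is in [F]; its image under [c] then clusters at [p],
   although [c] moves points by less than two thirds of [e]. *)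
exists p; have [//|Fn] := in_ultra_setVsetC (ball p e) FU.
have [] := clp (c @` (closure X `&` ~` ball p e)) (ball p (e / 3)).
- suff : F (c @^-1` (c @` (closure X `&` ~` ball p e))) by [].
  by apply: filterS (filterI FX Fn) => x ?; exists x.
- exact: nbhsx_ballx.
move=> _ [[x [clx px] <-]]; rewrite -ball_normE /= => pcx.
exfalso; apply: px; rewrite -ball_normE /=.
rewrite -[p](subrK (c x)) -addrA (le_lt_trans (ler_normD _ _))//.
have [_ xcx] := cP _ clx.
have -> : e = e / 3 + (e / 3 + e / 3) by field.
by rewrite ltrD// distrC.
Qed.

Lemma finite_set_inj (I J : Type) (D : set I) (E : set J) (f : I -> J) :
    finite_set E -> (forall n, D n -> E (f n)) ->
    (forall n k, D n -> D k -> f n = f k -> n = k) ->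
  finite_set D.
Proof.
move=> finE DE injf; have : {in D &, injective f}.
  by move=> n k /set_mem Dn /set_mem Dk; exact: injf.
move=> /inj_card_eq/eq_finite_set <-; apply: sub_finite_set finE.
by move=> _ [n /DE ? <-].
Qed.

(** Cover the closure of [X] by finitely many balls of radius [e / 2]: points at distance at least
    [e] never share one, so sending [n] to a ball around [f n] is injective on [D]. *)
Lemma separated_finite (I : Type) (D : set I) (f : I -> H) X e :
    precompact X -> 0 < e -> (forall n, D n -> X (f n)) ->
    (forall n k, D n -> D k -> n <> k -> e <= `|f n - f k|) ->
  finite_set D.
Proof.
rewrite precompactE compact_cover => cX e0 DX sep.
have e20 : 0 < e / 2 by rewrite divr_gt0.
have [|x _|G _ XG] := cX _ setT (fun x => (ball x (e / 2))).
- by move=> x _; exact: ball_open.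
- by exists x => //; exact: ballxx.
have near_G n : exists g, D n -> g \in G /\ `|g - f n| < e / 2.
  have [Dn|nDn] := pselect (D n); last by exists 0.
  have [g Gg] := XG _ (subset_closure (DX _ Dn)).
  by rewrite -ball_normE => gn; exists g.
have [g gP] := choice near_G.
apply: (finite_set_inj (f := g) (finite_fset G)) => [n /gP[]//|n k Dn Dk gnk].
apply: contrapT => /(sep _ _ Dn Dk); apply/negP; rewrite -real_ltNge; last 2 first.
- by rewrite ger0_real.
- by rewrite gtr0_real.
have [[_ gn] [_ gk]] := (gP _ Dn, gP _ Dk).
rewrite -[f n](subrK (g n)) -addrA (le_lt_trans (ler_normD _ _))//.
by rewrite [ltRHS]splitr ltrD//; [rewrite distrC|rewrite gnk].
Qed.

Lemma compact_add A B : compact A -> compact B ->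
  compact [set x | exists a b, [/\ A a, B b & x = a + b]].
Proof.
move=> cA cB; have := compact_setX cA cB.
move/(continuous_compact (f := fun z : H * H => z.1 + z.2)).
rewrite (_ : [set _ | _ in _] = [set x | exists a b, [/\ A a, B b & x = a + b]]).
  by apply; apply: continuous_subspaceT; exact: add_continuous.
apply/seteqP; split => [_ [[a b] [/= Aa Bb] <-]|x [a [b [Aa Bb ->]]]].
  by exists a, b.
by exists (a, b).
Qed.

Lemma compact_real_segment (v : H) (m : R) :
  compact [set t%:C%C *: v | t in `[- m, m]].
Proof.
apply: continuous_compact (@segment_compact _ _ _).
apply: continuous_subspaceT => t; apply/cvgrPdist_lt => e e0.
have nv0 : 0 < `|v| + 1 by rewrite ltr_wpDl.
have d0 : 0 < e / (`|v| + 1) by rewrite divr_gt0.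
have /RRe_real dE := gtr0_real d0.
near=> u; rewrite -scalerBl -rmorphB/= normrZ.
rewrite (@le_lt_trans _ _ (`|(t - u)%:C%C| * (`|v| + 1)))//.
  by rewrite ler_wpM2l// lerDl.
rewrite -ltr_pdivlMr// -dE normc_def/= expr0n addr0 sqrtr_sqr ltcR.
near: u; apply: cvgr_dist_lt; [exact: cvg_id|by rewrite -ltcR dE].
Unshelve. all: by end_near. Qed.

(** The disc lies in the square with real and imaginary parts in [[- m, m]]; its multiples of [v]
    lie in the sum of two compact segments, along [v] and [i v]. *)
Lemma compact_disc (v : H) (M : R[i]) :
  exists2 C : set H, compact C & forall a : R[i], `|a| <= M -> C (a *: v).
Proof.
(* A complex [M] need not be a nonnegative real; if it is not, no [a] meets the bound and the empty
   set serves. *)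
have [M0|M0] := pselect (0 <= M); last first.
  exists set0 => [|a aM]; first exact: compact0.
  by case: M0; exact: le_trans aM.
have /RRe_real ME := ger0_real M0; set m := complex.Re M in ME.
exists [set x | exists a b, [/\ [set t%:C%C *: v | t in `[- m, m]] a,
   [set t%:C%C *: ('i%C *: v) | t in `[- m, m]] b & x = a + b]].
  by apply: compact_add; exact: compact_real_segment.
move=> a aM; exists ((complex.Re a)%:C%C *: v), ((complex.Im a)%:C%C *: ('i%C *: v)).
have bound (b : R[i]) : `|b| <= M -> complex.Re b \in `[- m, m].
  move=> bM; rewrite in_itv/= -ler_norml -lecR ME.
  exact: le_trans (normc_ge_Re _) bM.
split; first by exists (complex.Re a) => //; exact: bound.
- exists (complex.Im a) => //.
  (* The imaginary part of [a] is minus the real part of [a * 'i%C], which has the same modulus. *)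
  have ai : `|a * 'i%C| <= M.
    by rewrite normrM complexiE normCi mulr1.
  by have := bound _ ai; rewrite /= !in_itv/= ReiNIm lerNl opprK andbC lerNl.
- by rewrite scalerA -scalerDl (mulrC _%:C%C) -complexE.
Qed.

(** The norm takes values in [R[i]], so the extreme value theorem is applied to its real part on the
    compact closure of [X]. *)
Lemma compact_norm_max X : precompact X -> X !=set0 ->
  exists2 w, closure X w & forall x, X x -> `|x| <= `|w|.
Proof.
rewrite precompactE => cX [x0 Xx0].
have nE (x : H) : (complex.Re `|x|)%:C%C = `|x| by rewrite RRe_real// ger0_real.
have [||w Xw wmax] := compact_EVT_max (f := fun x => complex.Re `|x|) _ cX.
- by exists x0; exact: subset_closure.
- apply: continuous_subspaceT => x; apply/cvgrPdist_lt => e e0.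
  near=> y; rewrite -raddfB -ltcR.
  apply: le_lt_trans (normc_ge_Re _) _.
  apply: le_lt_trans (ler_dist_dist _ _) _.
  by near: y; apply: cvgr_dist_lt; [exact: cvg_id|rewrite ltcR].
exists w => [|x Xx]; first exact: set_mem.
by rewrite -(nE x) -(nE w) lecR wmax// mem_set//; exact: subset_closure.
Unshelve. all: by end_near. Qed.

End NormedTopology.

(** * Algebraic closure properties of closed subspaces *)

Section Subspace.
Variables (R : realType) (H : completeNormedModType R[i]).
Variables (S : set H) (closedS : closed_subspace S).

Lemma subspace0 : S 0. Proof. by case: closedS. Qed.

Lemma subspaceZ (a : R[i]) x : S x -> S (a *: x).
Proof.
by case: closedS => S0 SP _ Sx; rewrite -[_ *: _]addr0; exact: SP.
Qed.

Lemma subspaceD x y : S x -> S y -> S (x + y).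
Proof.
by case: closedS => S0 SP _ Sx Sy; rewrite -[x]scale1r; exact: SP.
Qed.

Lemma subspaceB x y : S x -> S y -> S (x - y).
Proof.
by move=> Sx Sy; rewrite -scaleN1r addrC; case: closedS => _ + _; apply.
Qed.

Lemma subspace_sum (I : eqType) (s : seq I) (f : I -> H) :
  (forall i, i \in s -> S (f i)) -> S (\sum_(i <- s) f i).
Proof.
move=> Sf; rewrite big_seq; apply: (big_ind S) => //; first exact: subspace0.
exact: subspaceD.
Qed.

End Subspace.

(** * Fourier sums over an orthonormal family with an arbitrary index set *)

Section Fourier.
Variables (R : realType) (H : completeNormedModType R[i]).
Variables (dot : {dot H for @Num.conj R[i]}) (dot_norm : induces_norm dot).
Variables (I : choiceType) (B : set I) (psi : I -> H).
Hypothesis psi1 : forall n, B n -> dot (psi n) (psi n) = 1.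
Hypothesis psi0 : forall n k, B n -> B k -> n <> k -> dot (psi n) (psi k) = 0.
Implicit Types (G U : {fset I}) (x y z : H) (s : seq I).

Definition fourier_sum y G := \sum_(k <- G) dot y (psi k) *: psi k.

Lemma dot_sum_orthonormal s (c : I -> R[i]) k : uniq s ->
    (forall j, j \in s -> B j) -> B k ->
  dot (\sum_(j <- s) c j *: psi j) (psi k) = if k \in s then c k else 0.
Proof.
elim: s => [|j s IHs] /=; first by rewrite big_nil linear0l.
move=> /andP[js us] sB Bk; rewrite big_cons dotDl dotZl IHs//; last first.
  by move=> i si; apply: sB; rewrite in_cons si orbT.
have Bj : B j by apply: sB; rewrite mem_head.
rewrite in_cons; have [->|kj] := eqVneq k j.
  by rewrite (negbTE js) addr0 psi1// mulr1.
by rewrite psi0 ?mulr0 ?add0r// => jk; rewrite jk eqxx in kj.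
Qed.

Lemma normsq_sum_orthonormal s (c : I -> R[i]) : uniq s ->
    (forall j, j \in s -> B j) ->
  `|\sum_(j <- s) c j *: psi j| ^+ 2 = \sum_(j <- s) `|c j| ^+ 2.
Proof.
elim: s => [|j s IHs] /=; first by rewrite !big_nil normr0 expr0n.
move=> /andP[js us] sB.
have Bj : B j by apply: sB; rewrite mem_head.
have sB' i : i \in s -> B i by move=> si; apply: sB; rewrite in_cons si orbT.
rewrite !big_cons (pythagoras dot_norm)// ?IHs//.
  by rewrite normrZ exprMn dot_norm psi1// mulr1.
by apply: dot_eq0C; rewrite dotZr dot_sum_orthonormal// (negbTE js) mulr0.
Qed.

Lemma dot_fourier_resid y G k : (forall j, j \in G -> B j) -> k \in G ->
  dot (y - fourier_sum y G) (psi k) = 0.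
Proof.
move=> GB Gk; rewrite dotBl dot_sum_orthonormal ?fset_uniq//; last exact: GB.
by rewrite Gk subrr.
Qed.

Lemma dot_fourier_resid_sum y G U : (forall j, j \in U -> B j) -> (G `<=` U)%fset ->
  dot (y - fourier_sum y U) (fourier_sum y G) = 0.
Proof.
move=> UB /fsubsetP GU; rewrite /fourier_sum [X in dot _ X]big_seq dot_sumr.
rewrite big1// => k Gk; rewrite dotZr dot_fourier_resid ?mulr0//.
exact: GU.
Qed.

Lemma normsq_fourier_resid y G : (forall j, j \in G -> B j) ->
  `|y - fourier_sum y G| ^+ 2 = `|y| ^+ 2 - \sum_(k <- G) `|dot y (psi k)| ^+ 2.
Proof.
move=> GB; have := dot_fourier_resid_sum y GB (fsubset_refl G).
move/(pythagoras dot_norm); rewrite subrK => ->.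
by rewrite normsq_sum_orthonormal ?fset_uniq// addrK.
Qed.

(** The residual at [U] is orthogonal to the increment, and the two add up to the residual at [G];
    Pythagoras does the rest. *)
Lemma normsq_fourier_sub y G U : (forall j, j \in U -> B j) -> (G `<=` U)%fset ->
  `|fourier_sum y U - fourier_sum y G| ^+ 2 =
  \sum_(k <- U) `|dot y (psi k)| ^+ 2 - \sum_(k <- G) `|dot y (psi k)| ^+ 2.
Proof.
move=> UB GU; have GB j : j \in G -> B j by move=> /(fsubsetP GU)/UB.
have : dot (y - fourier_sum y U) (fourier_sum y U - fourier_sum y G) = 0.
  by rewrite dotBr !dot_fourier_resid_sum ?subrr.
move/(pythagoras dot_norm); rewrite addrA subrK !normsq_fourier_resid//.
set a := \sum_(k <- G) _; set b := \sum_(k <- U) _.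
by move=> E; apply: (addrI (`|y| ^+ 2 - b)); rewrite -E; ring.
Qed.

Variables (T : set H) (closedT : closed_subspace T).
Hypothesis TB : forall n, B n -> T (psi n).
Hypothesis psi_complete :
  forall x, T x -> (forall n, B n -> dot x (psi n) = 0) -> x = 0.


(* The Fourier sums whose square norms approach the supremum form a Cauchy
   filter; its limit has the same coefficients as [y]. *)
Lemma fourier_approx y (e : R[i]) : T y -> 0 < e ->
  exists2 G : {fset I}, (forall j, j \in G -> B j) & `|y - fourier_sum y G| < e.
Proof.
move=> Ty.
pose q G := \sum_(k <- G) `|dot y (psi k)| ^+ 2.
pose sub G := forall j, j \in G -> B j.
have q0 G : 0 <= q G by rewrite sumr_ge0// => k _; rewrite exprn_ge0.
have qE G : (complex.Re (q G))%:C%C = q G by rewrite RRe_real// ger0_real.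
have bessel G : sub G -> q G <= `|y| ^+ 2.
  by move=> GB; rewrite -subr_ge0 -normsq_fourier_resid// exprn_ge0.
pose Q := [set complex.Re (q G) | G in sub].
have hsQ : has_sup Q.
  split; first by exists (complex.Re (q fset0)), fset0 => // j; rewrite inE.
  exists (complex.Re (`|y| ^+ 2)) => _ [G GB <-].
  by rewrite -lecR qE RRe_real ?bessel// ger0_real ?exprn_ge0.
have Qsup G : sub G -> complex.Re (q G) <= sup Q.
  by move=> GB; apply: ub_le_sup; [exact: hsQ.2|exists G].
pose near_sup (eta : R) := [set G | sub G /\ sup Q - eta < complex.Re (q G)].
pose F := filter_from [set eta : R | 0 < eta]
  (fun eta => fourier_sum y @` near_sup eta).
have FF : ProperFilter F.
  apply: filter_from_proper => [|eta eta0]; last first.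
    have [_ [G GB <-] Geta] := sup_adherent eta0 hsQ.
    by exists (fourier_sum y G), G.
  apply: filter_from_filter => [|a b a0 b0]; first by exists 1 => /=.
  exists (Order.min a b); first by rewrite /= lt_min a0 b0.
  move=> _ [G [GB Gab] <-]; split; exists G => //; split=> //;
    by apply: le_lt_trans Gab; rewrite lerD2l lerN2 ge_min lexx ?orbT.
(* Enlarging a near-optimal [G] adds to the square sum at most its gap to the supremum, which is
   below [a ^+ 2]. *)
have close (a : R) G U : 0 < a -> near_sup (a ^+ 2) G -> sub U -> (G `<=` U)%fset ->
    `|fourier_sum y U - fourier_sum y G| < a%:C%C.
  move=> a0 [GB Ga] UB GU; rewrite -ltr_sqr ?nnegrE ?lecR ?(ltW a0)//.
  rewrite normsq_fourier_sub// -/(q U) -/(q G) -(qE U) -(qE G).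
  rewrite -rmorphB -rmorphXn/= ltcR.
  by have := Qsup _ UB; lra.
have : cauchy F.
  apply: cauchy_exP => d d0.
  have /RRe_real dE : d / 2 \is Num.real by rewrite gtr0_real ?divr_gt0.
  have d20 : 0 < complex.Re (d / 2) by rewrite -ltcR dE divr_gt0.
  have [_ [G GB_near _]] : exists x,
      (fourier_sum y @` near_sup (complex.Re (d / 2) ^+ 2)) x.
    apply: (@filter_ex _ F); exists (complex.Re (d / 2) ^+ 2) => //=.
    by rewrite exprn_gt0.
  exists (fourier_sum y G), (complex.Re (d / 2) ^+ 2); first by rewrite /= exprn_gt0.
  move=> _ [G' G'B_near <-]; rewrite -ball_normE /=.
  (* Two near-optimal sums are both close to the sum over the union of their index sets. *)
  have UB : sub (G `|` G')%fset.
    by move=> j; rewrite inE => /orP[/GB_near.1|/G'B_near.1].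
  rewrite [ltRHS]splitr -(subrK (fourier_sum y (G `|` G')%fset) (fourier_sum y G)).
  rewrite -addrA (le_lt_trans (ler_normD _ _))// ltrD//.
    by rewrite distrC -dE close// fsubsetUl.
  by rewrite -dE close// fsubsetUr.
move=> /cauchy_cvg/cvg_ex[z Fz].
have approx (a : R) : 0 < a ->
    exists2 G, near_sup (a ^+ 2) G & `|z - fourier_sum y G| < a%:C%C.
  move=> a0; have Fa : F (fourier_sum y @` near_sup (a ^+ 2)).
    by exists (a ^+ 2) => //=; rewrite exprn_gt0.
  have Fb : F (ball z a%:C%C) by apply: Fz; apply: nbhsx_ballx; rewrite ltcR.
  have [_ [[G Ga <-] zG]] := filter_ex (filterI Fa Fb).
  by exists G; rewrite // -ball_normE in zG.
have Tsum G : sub G -> T (fourier_sum y G).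
  by move=> GB; apply: subspace_sum => // j Gj; apply: subspaceZ => //; exact/TB/GB.
have approxC (d : R[i]) : 0 < d ->
    exists2 G, near_sup (complex.Re d ^+ 2) G & `|z - fourier_sum y G| < d.
  move=> d0; have /RRe_real dE := gtr0_real d0.
  by rewrite -{2}dE; apply: approx; rewrite -ltcR dE.
have Tz : T z.
  case: closedT => _ _ /closure_id ->; apply/closure_normP => d /approxC[G [GB _] Gz].
  by exists (fourier_sum y G); rewrite //; exact: Tsum.
have yz : y = z.
  apply/eqP; rewrite -subr_eq0; apply/eqP; apply: psi_complete => [|n Bn].
    exact: subspaceB.
  apply/eqP; rewrite -normr_le0 real_leNgt//; apply/negP => c0.
  set c := `|dot (y - z) (psi n)| in c0.
  have d0 : 0 < c / 2 by rewrite divr_gt0.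
  have /RRe_real dE := gtr0_real d0.
  have [G Gd zG] := approxC _ d0.
  (* Adjoining [n] makes the residual of [y] orthogonal to [psi n]; the two other terms contribute
     less than [c / 2] each, so [c < c]. *)
  have UB : sub (n |` G)%fset by move=> j; rewrite !inE => /predU1P[->//|/(Gd.1)].
  have nE : `|psi n| = 1.
    by apply/eqP; rewrite -(@eqrXn2 _ 2)// dot_norm psi1// expr1n.
  have : c < c.
    rewrite {1}/c [ltRHS]splitr.
    rewrite (_ : y - z = (y - fourier_sum y (n |` G)%fset) +
      ((fourier_sum y (n |` G)%fset - fourier_sum y G) + (fourier_sum y G - z))); last first.
      by rewrite !subrKA.
    rewrite dotDl dot_fourier_resid ?add0r ?fset1U1// dotDl.
    rewrite (le_lt_trans (ler_normD _ _))// ltrD//.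
      rewrite (le_lt_trans (cauchy_schwarz dot_norm _ _))// nE mulr1 -dE.
      by rewrite close// ?fsubsetU1// -ltcR dE.
    by rewrite (le_lt_trans (cauchy_schwarz dot_norm _ _))// nE mulr1 distrC.
  by rewrite ltxx.
by move=> /approxC[G [GB _] zG]; exists G => //; rewrite {1}yz.
Qed.

End Fourier.

(** * Orthogonal projections: uniqueness, linearity, contractivity *)

Section Projection.
Variables (R : realType) (H : completeNormedModType R[i]).
Variables (dot : {dot H for @Num.conj R[i]}) (dot_norm : induces_norm dot).
Variables (S : set H) (closedS : closed_subspace S).
Variables (P : H -> H) (projP : orthogonal_projection dot S P).

Lemma proj_mem x : S (P x).
Proof. by have [] := projP x. Qed.

Lemma dot_projl x y : S y -> dot (P x) y = dot x y.
Proof.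
have [_ Pxy] := projP x.
by move=> /Pxy/eqP; rewrite dotBl subr_eq0 => /eqP.
Qed.

Lemma dot_projr x y : S y -> dot y (P x) = dot y x.
Proof. by move=> Sy; rewrite dotC dot_projl// -dotC. Qed.

Lemma proj_unique x u : S u -> (forall y, S y -> dot u y = dot x y) -> P x = u.
Proof.
move=> Su xu; apply/eqP; rewrite -subr_eq0 -(dnorm_eq0 dot).
have SPu : S (P x - u) by apply: subspaceB => //; exact: proj_mem.
by rewrite dotBl dot_projl// xu// subrr.
Qed.

Lemma proj_id x : S x -> P x = x.
Proof. by move=> Sx; exact: proj_unique. Qed.

Lemma proj_linear : linear P.
Proof.
move=> a x y; apply: proj_unique => [|z Sz].
  by case: closedS => _ + _; apply; exact: proj_mem.
by rewrite !dotDl !dotZl !dot_projl.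
Qed.

Lemma normsq_proj x : `|P x| ^+ 2 = dot x (P x).
Proof. by rewrite dot_norm dot_projl//; exact: proj_mem. Qed.

(** The square of the norm of [P x] is [dot x (P x)]; apply Cauchy-Schwarz and cancel one factor. *)
Lemma norm_proj_le x : `|P x| <= `|x|.
Proof.
have [->|Px0] := eqVneq (P x) 0; first by rewrite normr0.
rewrite -(@ler_pM2r _ `|P x|) ?normr_gt0// -expr2.
have := cauchy_schwarz dot_norm x (P x).
by rewrite -normsq_proj ger0_norm ?exprn_ge0.
Qed.

End Projection.

(** * Finite linear combinations with bounded coefficients *)

Lemma linear_sum_seq (K : pzRingType) (U V : lmodType K) (f : U -> V)
    (I : Type) (s : seq I) (c : I -> K) (v : I -> U) : linear f ->
  f (\sum_(n <- s) c n *: v n) = \sum_(n <- s) c n *: f (v n).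
Proof.
move=> linf; elim: s => [|n s IHs]; last by rewrite !big_cons linf IHs.
(* Linearity with coefficient [-1] at 0 gives [f 0 = 0], the empty case. *)
by have := linf (-1) 0 0; rewrite !big_nil scaler0 addr0 scaleN1r addNr.
Qed.

Section CompactSums.
Variables (R : realType) (H : completeNormedModType R[i]).

(** Each new vector adds a compact disc of multiples. [C] depends on [s], [v] and [M] only, so it
    serves all bounded coefficient families at once. *)
Lemma compact_bounded_span (I : Type) (s : seq I) (v : I -> H) (M : R[i]) :
  exists2 C : set H, compact C &
    forall c : I -> R[i], (forall n, `|c n| <= M) -> C (\sum_(n <- s) c n *: v n).
Proof.
elim: s => [|n s [C cC sC]].
  by exists [set 0] => [|c _]; [exact: compact_set1|rewrite big_nil].
have [D cD nD] := compact_disc (v n) M.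
exists [set x | exists a b, [/\ D a, C b & x = a + b]]; first exact: compact_add.
move=> c cM; rewrite big_cons; exists (c n *: v n), (\sum_(m <- s) c m *: v m).
by split=> //; [exact: nD|exact: sC].
Qed.

Lemma bounded_setP (X : set H) : bounded_set X <->
  exists2 M : R[i], 0 < M & forall x, X x -> `|x| <= M.
Proof.
split=> [[M [Mr XM]]|[M M0 XM]].
  exists (`|M| + 1) => [|x Xx]; first by rewrite ltr_wpDl.
  by apply: XM => //; rewrite (le_lt_trans (real_ler_norm Mr))// ltrDl.
exists M; split; first exact: gtr0_real.
by move=> N MN x Xx; exact: le_trans (XM _ Xx) (ltW MN).
Qed.

End CompactSums.

(** * From diagonal bases to compactness *)

Section DiagonalBases.
Variables (R : realType) (H : completeNormedModType R[i]).
Variables (dot : {dot H for @Num.conj R[i]}) (dot_norm : induces_norm dot).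
Variables (S T : set H).
Hypotheses (closedS : closed_subspace S) (closedT : closed_subspace T).
Variables (PS PT : H -> H).
Hypotheses (projS : orthogonal_projection dot S PS).
Hypotheses (projT : orthogonal_projection dot T PT).
Variables (I : choiceType) (A B : set I) (xi psi : I -> H).
Hypotheses (basis_xi : orthonormal_basis dot S A xi).
Hypotheses (basis_psi : orthonormal_basis dot T B psi).
Hypothesis diag : forall n k, A n -> B k -> n <> k -> dot (xi n) (psi k) = 0.

Lemma norm_basis (J : Type) (V : set H) (C : set J) (e : J -> H) n :
  orthonormal_basis dot V C e -> C n -> `|e n| = 1.
Proof.
case=> _ e1 _ _ Cn; apply/eqP.
by rewrite -(@eqrXn2 _ 2)// dot_norm e1// expr1n.
Qed.

(** Both sides have the same inner product with every [xi k]: diagonality kills all but [k = n]. For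
    [n] outside [A] nothing is left, and [psi n] is orthogonal to [S]. *)
Lemma proj_diagonal n : B n ->
  PS (psi n) = if `[<A n>] then (dot (xi n) (psi n))^* *: xi n else 0.
Proof.
case: basis_xi => Sxi xi1 xi0 xi_complete Bn.
set u := if _ then _ else _.
have Su : S u.
  rewrite /u; case: asboolP => [An|_]; last exact: subspace0.
  by apply: subspaceZ => //; exact: Sxi.
apply/eqP; rewrite -subr_eq0; apply/eqP; apply: xi_complete => [|k Ak].
  by apply: subspaceB => //; exact: proj_mem projS _.
rewrite dotBl (dot_projl projS)//; last exact: Sxi.
have [kn|kn] := pselect (k = n).
  rewrite kn in Ak *.
  by rewrite /u asboolT// dotZl xi1// mulr1 -dotC subrr.
have -> : dot (psi n) (xi k) = 0 by apply: dot_eq0C; exact: diag.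
rewrite sub0r /u; case: asboolP => [An|_].
  by rewrite dotZl xi0 ?mulr0 ?oppr0// => nk; apply: kn.
by rewrite linear0l oppr0.
Qed.

Lemma compact_diagonal :
    (forall e : R[i], 0 < e ->
       finite_set [set n | [/\ A n, B n & e <= `|dot (xi n) (psi n)|]]) ->
  compact_operator (PS \o PT).
Proof.
move=> fin_large; split.
  move=> a x y /=; rewrite (proj_linear closedT projT).
  by rewrite (proj_linear closedS projS).
have [Tpsi psi1 psi0 psi_complete] := basis_psi.
have [Sxi xi1 xi0 _] := basis_xi.
move=> X /bounded_setP[M M0 XM]; apply: precompact_approx => e e0.
have e20 : 0 < e / 2 by rewrite divr_gt0.
(* Factors below [d], acting on a vector of norm at most [M], contribute at most [d * M = e / 2]. *)
pose d := e / 2 / M.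
have d0 : 0 < d by rewrite divr_gt0.
pose s n := dot (xi n) (psi n).
pose D := fset_set [set n | [/\ A n, B n & d <= `|s n|]].
have DP n : n \in D <-> [/\ A n, B n & d <= `|s n|].
  rewrite in_fset_set; last exact: fin_large.
  by split=> [/set_mem|/mem_set].
have [C cC DC] := compact_bounded_span D xi M.
exists C => // _ [x Xx <-] /=.
have yM : `|PT x| <= M by rewrite (le_trans (norm_proj_le dot_norm projT x))// XM.
set y := PT x in yM *.
have Ty : T y by exact: proj_mem projT x.
have [G GB yG] := fourier_approx dot_norm psi1 psi0 closedT Tpsi psi_complete Ty e20.
pose b n := dot y (psi n).
have b_le n : B n -> `|b n| <= M.
  move=> Bn; rewrite (le_trans (cauchy_schwarz dot_norm _ _))//.
  by rewrite (norm_basis basis_psi Bn) mulr1.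
have s_le n : A n -> B n -> `|s n| <= 1.
  move=> An Bn; rewrite (le_trans (cauchy_schwarz dot_norm _ _))//.
  by rewrite (norm_basis basis_psi Bn) (norm_basis basis_xi An) mulr1.
have PSG : PS (fourier_sum dot psi y G) =
    \sum_(n <- G | `[<A n>]) (b n * (s n)^*) *: xi n.
  rewrite linear_sum_seq; last exact: proj_linear projS.
  rewrite [RHS]big_mkcond/= big_seq [RHS]big_seq; apply: eq_bigr => n Gn.
  rewrite proj_diagonal; last exact: GB.
  by case: ifP; rewrite ?scaler0 ?scalerA.
(* Coefficients are set to 0 outside [G] and outside the common indices, so that the bound [M]
   required by [DC] holds at every index. *)
pose c n := if n \in G then b n * (s n)^* else 0.
pose c' n := if `[<A n /\ B n>] then c n else 0.
exists (\sum_(n <- D) c' n *: xi n).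
  apply: DC => n; rewrite /c' /c; case: asboolP => [[An Bn]|_]; last first.
    by rewrite normr0 ltW.
  case: ifP => _; last by rewrite normr0 ltW.
  rewrite normrM norm_conjC -[leRHS]mulr1.
  by apply: ler_pM => //; [exact: b_le|exact: s_le].
have DG : \sum_(n <- D) c' n *: xi n =
    \sum_(n <- G | `[<A n>] && (n \in D)) (b n * (s n)^*) *: xi n.
  transitivity (\sum_(n <- D | n \in G) (b n * (s n)^* ) *: xi n).
    rewrite [RHS]big_mkcond big_seq [RHS]big_seq; apply: eq_bigr => n /DP[An Bn _].
    by rewrite /c' /c asboolT//; case: ifP; rewrite ?scale0r.
  rewrite -big_filter -[RHS]big_filter; apply: perm_big; apply: uniq_perm.
  - by rewrite filter_uniq// fset_uniq.
  - by rewrite filter_uniq// fset_uniq.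
  move=> n; rewrite !mem_filter andbC; case: (boolP (n \in D)) => [/DP[An _ _]|_].
    by rewrite asboolT// andbT.
  by rewrite andbF.
(* Two errors of [e / 2]: replacing [y] by its Fourier sum, and dropping the indices outside [D]. *)
rewrite -[PS y](subrK (PS (fourier_sum dot psi y G))) -addrA.
rewrite (le_lt_trans (ler_normD _ _))// [ltRHS]splitr; apply: ltr_leD.
  have -> : PS y - PS (fourier_sum dot psi y G) = PS (y - fourier_sum dot psi y G).
    rewrite -[in RHS]scaleN1r [in RHS]addrC (proj_linear closedS projS).
    by rewrite scaleN1r addrC.
  by rewrite (le_lt_trans (norm_proj_le dot_norm projS _)).
rewrite PSG DG (bigID (mem D))/= addrAC subrr add0r -big_filter.
rewrite -[leLHS]ger0_norm// -[leRHS]ger0_norm ?(ltW e20)// -ler_sqr ?nnegrE//.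
rewrite !normr_id (normsq_sum_orthonormal dot_norm xi1 xi0) ?filter_uniq
  ?fset_uniq//; last first.
  by move=> n; rewrite mem_filter => /andP[/andP[/asboolP]].
(* Outside [D] each [s n] has modulus below [d], and Bessel's inequality bounds the remaining sum of
   squares by [M ^+ 2]. *)
rewrite (@le_trans _ _ (d ^+ 2 * \sum_(n <- G) `|b n| ^+ 2))//.
  rewrite big_filter mulr_sumr [leRHS](bigID (fun n => `[<A n>] && (n \notin D)))/=.
  rewrite big_seq_cond [X in _ <= X + _]big_seq_cond.
  rewrite -[leLHS]addr0 lerD//; last first.
    by rewrite sumr_ge0// => n _; rewrite mulr_ge0 ?exprn_ge0// ltW.
  apply: ler_sum => n /andP[Gn /andP[/asboolP An nD]].
  rewrite normrM norm_conjC exprMn mulrC ler_wpM2r ?exprn_ge0//.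
  rewrite ler_sqr ?nnegrE ?(ltW d0)// real_leNgt ?(gtr0_real d0)//.
  apply: contra nD => /ltW ds; apply/DP; split=> //; exact: GB.
rewrite (@le_trans _ _ (d ^+ 2 * M ^+ 2))//.
  rewrite ler_wpM2l ?exprn_ge0 ?(ltW d0)//.
  rewrite (@le_trans _ _ (`|y| ^+ 2))//; last by rewrite ler_sqr ?nnegrE ?(ltW M0).
  by rewrite -subr_ge0 -(normsq_fourier_resid dot_norm psi1 psi0)// exprn_ge0.
by rewrite -exprMn divfK ?gt_eqF// ger0_norm// ltW.
Qed.

End DiagonalBases.

(** * Maximal families for a pairwise relation, by Zorn's lemma *)

Lemma maximal_pairwise (U : Type) (good : set U) (compat : U -> U -> Prop) :
  exists Z : set U, [/\ Z `<=` good,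
    forall z z', Z z -> Z z' -> z <> z' -> compat z z' &
    forall z, good z -> (forall z', Z z' -> compat z z' /\ compat z' z) -> Z z].
Proof.
pose P (Z : set U) := Z `<=` good /\
  forall z z', Z z -> Z z' -> z <> z' -> compat z z'.
have [F FP totF|Z [[Zgood Zcompat] maxZ]] := @Zorn_bigcup U P.
  split=> [z [Z FZ Zz]|z z' [Z FZ Zz] [Z' FZ' Z'z']].
    by have [Zgood _] := FP _ FZ; exact: Zgood.
  (* Two elements of the union of a chain lie in a common member of it. *)
  have [ZZ'|Z'Z] := totF _ _ FZ FZ'.
    by have [_] := FP _ FZ'; apply => //; exact: ZZ'.
  by have [_] := FP _ FZ; apply => //; exact: Z'Z.
exists Z; split => // z zgood zcompat; apply: contrapT => nZz.
apply: (maxZ (z |` Z)).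
  by split=> [y|/(_ z (or_introl erefl))//]; right.
split=> [_ [->//|/Zgood//]|z1 z2].
move=> [->|Zz1] [->|Zz2] //; [|by move=> _; exact: (zcompat _ Zz1).2|exact: Zcompat].
by move=> _; exact: (zcompat _ Zz2).1.
Qed.

(** * Convergence along the cofinite filter *)

Section Cofinite.
Variable I : Type.

(** For finite [I] the empty set is cofinite too, so this filter can be improper. *)
Lemma cofinite_filter : Filter (@cofinite I).
Proof.
split=> [|P Q finP finQ|P Q PQ finP]; rewrite /cofinite/=.
- by rewrite setCT.
- by rewrite setCI finite_setU.
- by apply: sub_finite_set finP; apply: subsetC.
Qed.

Lemma cvg0_cofiniteP (R : realType) (D : set I) (f : I -> R[i]) :
  ((f : I -> R[i]^o) @ within D (@cofinite I) --> (0 : R[i]^o)) <->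
  forall e : R[i], 0 < e -> finite_set [set n | D n /\ e <= `|f n|].
Proof.
have FF := cofinite_filter.
have bad e : 0 < e -> ~` [set n | D n -> `|f n| < e] = [set n | D n /\ e <= `|f n|].
  move=> e0; apply/seteqP; split=> n /=.
    move=> /not_implyP[Dn /negP]; rewrite -real_leNgt//; exact: gtr0_real.
  by move=> [Dn en] /(_ Dn); rewrite real_ltNge ?en//; exact: gtr0_real.
split=> [/cvgr0Pnorm_lt f0 e e0|f0].
  by rewrite -bad//; exact: f0.
apply/cvgr0Pnorm_lt => e e0; have := f0 e e0.
by rewrite -bad.
Qed.

End Cofinite.

Lemma eventually_cofinite : (\oo : set_system nat) = @cofinite nat.
Proof.
apply/seteqP; split=> P; rewrite /cofinite/=.
  move=> [N _ NP]; apply: sub_finite_set (finite_II N) => n nP /=.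
  by rewrite ltnNge; apply/negP => /NP.
move=> /finite_fsetP[X PX]; exists (\max_(i <- X) i).+1 => // n /= Xn.
apply: contrapT => nP; have : (~` P) n by [].
rewrite PX /= => /(@leq_bigmax_seq _ _ xpredT id) /(_ isT) /(leq_trans Xn).
by rewrite ltnn.
Qed.

(** * From compactness to diagonal bases *)

Section Singular.
Variables (R : realType) (H : completeNormedModType R[i]).
Variables (dot : {dot H for @Num.conj R[i]}) (dot_norm : induces_norm dot).

Lemma dot_closure0 (X : set H) x v :
  closure X x -> (forall y, X y -> dot y v = 0) -> dot x v = 0.
Proof.
move=> /closure_normP clx Xv; apply/eqP; rewrite -normr_le0.
rewrite real_leNgt//; apply/negP => c0.
have nv0 : 0 < `|v| + 1 by rewrite ltr_wpDl.
have [|y Xy] := clx (`|dot x v| / (`|v| + 1)); first by rewrite divr_gt0.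
rewrite ltr_pdivlMr// => xy.
suff : `|dot x v| < `|dot x v| by rewrite ltxx.
apply: le_lt_trans xy; have -> : dot x v = dot (x - y) v by rewrite dotBl (Xv y)// subr0.
by rewrite (le_trans (cauchy_schwarz dot_norm _ _))// ler_wpM2l// lerDl.
Qed.

Lemma normalize x : x != 0 -> dot (`|x|^-1 *: x) (`|x|^-1 *: x) = 1.
Proof.
move=> x0; rewrite -dot_norm normrZ normfV normr_id mulVf ?expr1n//.
by rewrite normr_eq0.
Qed.

(** [E] is a maximal orthonormal set in the part of [V] orthogonal to the [e j]. A nonzero vector
    orthogonal to all of these would, once normalized, belong to [E] and be orthogonal to itself. *)
Lemma complete_orthonormal (V : set H) (J : Type) (C : set J) (e : J -> H) :
    closed_subspace V ->
  exists E : set H,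
    [/\ forall x, E x -> V x /\ forall j, C j -> dot x (e j) = 0,
        forall x, E x -> dot x x = 1,
        forall x y, E x -> E y -> x <> y -> dot x y = 0 &
        forall x, V x -> (forall j, C j -> dot x (e j) = 0) ->
          (forall y, E y -> dot x y = 0) -> x = 0].
Proof.
move=> closedV.
have [E [Egood Eorth Emax]] := maximal_pairwise
  [set x | [/\ V x, forall j, C j -> dot x (e j) = 0 & dot x x = 1]]
  (fun x y => dot x y = 0).
exists E; split => [x /Egood[]//|x /Egood[]//|//|x Vx xC xE].
apply: contrapT => /eqP x0.
have xx := normalize x0.
suff /xE : E (`|x|^-1 *: x).
  rewrite -[X in dot X _](scalerKV (_ : `|x| != 0)) ?normr_eq0// dotZl xx mulr1.
  by move/eqP; rewrite normr_eq0 (negbTE x0).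
apply: Emax => [|y Ey]; last first.
  suff xy : dot (`|x|^-1 *: x) y = 0 by split; [|exact: dot_eq0C].
  by rewrite dotZl xE// mulr0.
split=> // [|j Cj]; first exact: subspaceZ.
by rewrite dotZl xC// mulr0.
Qed.

Variables (S T : set H).
Hypotheses (closedS : closed_subspace S) (closedT : closed_subspace T).
Variables (PS PT : H -> H).
Hypotheses (projS : orthogonal_projection dot S PS).
Hypotheses (projT : orthogonal_projection dot T PT).
Hypothesis compactST : compact_operator (PS \o PT).

(** Up to phase, [p.1] and [p.2] are left and right singular vectors of [PS \o PT], with the modulus
    of [dot p.1 p.2] as singular value. *)
Definition singular_pair (p : H * H) :=
  [/\ S p.1 /\ T p.2, dot p.1 p.1 = 1 /\ dot p.2 p.2 = 1,
      PS p.2 = dot p.2 p.1 *: p.1, PT p.1 = dot p.1 p.2 *: p.2 &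
      dot p.1 p.2 != 0].

(* The maximum [M] of the norm on [PS] of the unit ball of [T1] is attained in
   the closure only, at [w]; testing [w] against that ball gives
   [M ^+ 2 <= `|PT w|], whence equality in Cauchy-Schwarz for [PS (PT w)] and
   [w]. *)
Lemma singular_pair_exists (S1 T1 : set H) t0 :
    closed_subspace S1 -> closed_subspace T1 -> S1 `<=` S -> T1 `<=` T ->
    (forall t, T1 t -> S1 (PS t)) -> (forall x, S1 x -> T1 (PT x)) ->
    T1 t0 -> PS t0 != 0 ->
  exists p, [/\ singular_pair p, S1 p.1 & T1 p.2].
Proof.
move=> closedS1 closedT1 S1S T1T PST1 PTS1 T1t0 PSt0.
have lin0 : PS 0 = 0 by apply: (proj_id closedS projS); exact: subspace0.
have linZ a x : PS (a *: x) = a *: PS x.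
  by rewrite -[a *: x]addr0 (proj_linear closedS projS) lin0 addr0.
have linTZ a x : PT (a *: x) = a *: PT x.
  have lin0T : PT 0 = 0 by apply: (proj_id closedT projT); exact: subspace0.
  by rewrite -[a *: x]addr0 (proj_linear closedT projT) lin0T addr0.
pose X := PS @` [set t | T1 t /\ `|t| <= 1].
have cX : precompact X.
  have [_ /(_ [set t : H | `|t| <= 1])] := compactST.
  move=> /(_ _)/precompact_subset; apply; last first.
    by apply/bounded_setP; exists 1.
  by move=> _ [t [T1t t1] <-]; exists t => //=; rewrite (proj_id closedT projT)//; exact: T1T.
have [|w clw wmax] := compact_norm_max cX.
  by exists (PS 0), 0 => //; split; [exact: subspace0|rewrite normr0].
set M := `|w| in wmax.
have PS_le t : T1 t -> `|PS t| <= M * `|t|.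
  move=> T1t; have [->|t_neq0] := eqVneq t 0; first by rewrite lin0 !normr0 mulr0.
  have nt : 0 < `|t| by rewrite normr_gt0.
  have : X (PS (`|t|^-1 *: t)).
    exists (`|t|^-1 *: t) => //; split; first exact: subspaceZ.
    by rewrite normrZ normfV normr_id mulVf ?gt_eqF.
  by move=> /wmax; rewrite linZ normrZ normfV normr_id ler_pdivrMl// mulrC.
have M0 : 0 < M.
  rewrite lt_neqAle normr_ge0 andbT eq_sym; apply/negP => /eqP ME.
  by move: (PS_le _ T1t0); rewrite ME mul0r normr_le0 (negbTE PSt0).
have S1w : S1 w.
  case: closedS1 => _ _ /closure_id ->; apply: closure_subset clw.
  by move=> _ [t [T1t _] <-]; exact: PST1.
have Sw : S w by exact: S1S.
have M2real : M ^+ 2 \is Num.real by rewrite rpredX// normr_real.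
set v := PT w; have T1v : T1 v by exact: PTS1.
have vv : dot v v = `|v| ^+ 2 by rewrite dot_norm.
have vw : dot v w = `|v| ^+ 2.
  by rewrite dotC -(normsq_proj dot_norm projT)// conj_Creal// rpredX// ger0_real.
have wv : dot w v = `|v| ^+ 2 by rewrite (normsq_proj dot_norm projT).
have M2v : M ^+ 2 <= `|v|.
  rewrite real_leNgt//; apply/negP => vM.
  have e0 : 0 < (M ^+ 2 - `|v|) / M by rewrite divr_gt0// subr_gt0.
  have [_ [t [T1t t1] <-]] := (closure_normP X w).1 clw _ e0.
  have Tt : T t by exact: T1T.
  rewrite ltr_pdivlMr// ltrBrDr => wt.
  suff Mle : M ^+ 2 <= `|w - PS t| * M + `|v|.
    by have := le_lt_trans Mle wt; rewrite ltxx.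
  have <- : `|dot w w| = M ^+ 2 by rewrite -dot_norm ger0_norm// exprn_ge0.
  (* Split [dot w w] at [PS t]: the term [dot w (PS t)] equals [dot v t], at most the norm of [v]
     since [t] is in the unit ball. *)
  rewrite -[X in dot _ X](subrK (PS t)) dotDr (le_trans (ler_normD _ _))// lerD//.
    by rewrite (le_trans (cauchy_schwarz dot_norm _ _))// mulrC.
  rewrite (dot_projr projS)// -(dot_projl projT)//.
  by rewrite (le_trans (cauchy_schwarz dot_norm _ _))// ler_piMr.
have MC : (M ^+ 2)^* = M ^+ 2 by exact: conj_Creal.
have PSv : PS v = M ^+ 2 *: w.
  apply/eqP; rewrite -subr_eq0 -normr_le0 -(@ler_pXn2r _ 2)// ?nnegrE// expr0n/=.
  (* The squared norm of [PS v - M ^+ 2 *: w] expands to a sum of two nonpositive differences, one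
     by [PS_le], one by [M2v]. *)
  rewrite dot_norm dotBl !dotBr !dotZl !dotZr MC -!dot_norm.
  rewrite (dot_projl projS)// (dot_projr projS)// vw wv -/M.
  have PSv2 : `|PS v| ^+ 2 <= M ^+ 2 * `|v| ^+ 2.
    by rewrite -exprMn ler_sqr ?nnegrE ?mulr_ge0 ?(ltW M0)// PS_le.
  have M4v : M ^+ 2 * (M ^+ 2) ^+ 2 <= M ^+ 2 * `|v| ^+ 2.
    by rewrite ler_wpM2l ?exprn_ge0 ?(ltW M0)// ler_sqr ?nnegrE ?exprn_ge0 ?(ltW M0).
  rewrite -subr_le0 (_ : _ - _ = (`|PS v| ^+ 2 - M ^+ 2 * `|v| ^+ 2) +
      (M ^+ 2 * (M ^+ 2) ^+ 2 - M ^+ 2 * `|v| ^+ 2)); last by ring.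
  by rewrite -[leRHS]addr0 lerD// subr_le0.
have v4 : `|v| ^+ 2 = M ^+ 4.
  rewrite -wv -(dot_projr projS)// PSv dotZr MC -dot_norm -/M.
  by rewrite -exprD.
have Mneq0 : M != 0 by rewrite gt_eqF.
have MVC k : ((M ^- k)^* : R[i]) = M ^- k.
  by apply: conj_Creal; rewrite rpredV rpredX// normr_real.
(* [w] has norm [M] and [v] has norm [M ^+ 2]; the normalized vectors have inner product [M]. *)
exists (M ^- 1 *: w, M ^- 2 *: v); split=> /=.
- have psixi : dot (M ^- 2 *: v) (M ^- 1 *: w) = M.
    by rewrite dotZl dotZr MVC vw v4; field.
  have xipsi : dot (M ^- 1 *: w) (M ^- 2 *: v) = M.
    by rewrite dotZl dotZr MVC wv v4; field.
  split => //=.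
  - by split; apply: subspaceZ => //; exact: T1T.
  - by rewrite !dotZl !dotZr !MVC vv v4 -dot_norm -/M; split; field.
  - by rewrite psixi linZ PSv !scalerA; congr (_ *: _); field.
  - by rewrite xipsi linTZ !scalerA; congr (_ *: _); field.
  - by rewrite xipsi.
- exact: subspaceZ.
- exact: subspaceZ.
Qed.

Definition orthogonal_complement_in (V : set H) (J : Type) (C : set J) (e : J -> H) :=
  [set x | V x /\ forall j, C j -> dot x (e j) = 0].

Lemma closed_orthogonal_complement (V : set H) (J : Type) (C : set J) (e : J -> H) :
  closed_subspace V -> closed_subspace (orthogonal_complement_in V C e).
Proof.
move=> closedV; split.
- by split; [exact: subspace0|move=> j _; rewrite linear0l].
- move=> a x y [Vx xC] [Vy yC]; split=> [|j Cj].
    by case: closedV => _ + _; apply.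
  by rewrite dotDl dotZl xC// yC// mulr0 addr0.
- move=> x clx; split=> [|j Cj].
    case: closedV => _ _ /closure_id ->; apply: closure_subset clx.
    by move=> y [].
  by apply: dot_closure0 clx _ => y [_]; apply.
Qed.

Lemma compact_has_diagonal_bases :
  exists I : Type, has_diagonal_bases dot S T (@cofinite I).
Proof.
have [Z [Zsing Zorth Zmax]] := maximal_pairwise singular_pair
  (fun p q => dot p.1 q.1 = 0 /\ dot p.2 q.2 = 0).
pose S1 := orthogonal_complement_in S Z fst.
pose T1 := orthogonal_complement_in T Z snd.
have S1_closed : closed_subspace S1 by exact: closed_orthogonal_complement.
have T1_closed : closed_subspace T1 by exact: closed_orthogonal_complement.
(* For [p] in [Z], [dot (PS t) p.1] equals [dot t (PT p.1)], and [PT p.1] is a multiple of [p.2];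
   symmetrically for [PTS1]. *)
have PST1 t : T1 t -> S1 (PS t).
  move=> [Tt tZ]; split=> [|p Zp]; first exact: proj_mem projS _.
  have [[Sp _] _ _ PTp _] := Zsing _ Zp.
  by rewrite (dot_projl projS)// -(dot_projr projT)// PTp dotZr tZ// mulr0.
have PTS1 x : S1 x -> T1 (PT x).
  move=> [Sx xZ]; split=> [|p Zp]; first exact: proj_mem projT _.
  have [[_ Tp] _ PSp _ _] := Zsing _ Zp.
  by rewrite (dot_projl projT)// -(dot_projr projS)// PSp dotZr xZ// mulr0.
have PST1_0 t : T1 t -> PS t = 0.
  move=> T1t; apply: contrapT => /eqP PSt.
  have [||p [p_sing S1p T1p]] := singular_pair_exists S1_closed T1_closed _ _ PST1 PTS1 T1t PSt.
  - by move=> x [].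
  - by move=> x [].
  (* Orthogonal to all of [Z], the new pair belongs to [Z] by maximality, so [p.1] would be
     orthogonal to itself. *)
  have Zp : Z p.
    apply: Zmax => // q Zq; have [[_ pq1] [_ pq2]] := (S1p, T1p).
    by split; split; rewrite ?pq1 ?pq2//; apply: dot_eq0C; rewrite ?pq1 ?pq2.
  have [_ [p1 _] _ _ _] := p_sing; have [_ /(_ _ Zp)/eqP] := S1p.
  by rewrite p1 oner_eq0.
have T1S t x : T1 t -> S x -> dot x t = 0.
  by move=> T1t Sx; rewrite -(dot_projr projS)// PST1_0// linear0r.
(* [PT x] lies in [T1], hence is orthogonal to [S], so its squared norm [dot x (PT x)] vanishes. *)
have S1T x t : S1 x -> T t -> dot x t = 0.
  move=> S1x Tt; rewrite -(dot_projl projT)//.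
  suff -> : PT x = 0 by rewrite linear0l.
  apply/eqP; rewrite -normr_eq0 -sqrf_eq0 (normsq_proj dot_norm projT).
  by rewrite T1S//; [exact: PTS1|case: S1x].
have [ES [ES1 ESn ESorth ESmax]] := complete_orthonormal Z fst closedS.
have [ET [ET1 ETn ETorth ETmax]] := complete_orthonormal Z snd closedT.
(* The members of a singular pair share an index; the completions in [S] and in [T] get separate
   labels, so the common indices are those of [Z]. *)
exists ((H * H) + (H + H))%type.
pose A (i : (H * H) + (H + H)) := match i with
  | inl p => Z p | inr (inl x) => ES x | inr (inr _) => False end.
pose B (i : (H * H) + (H + H)) := match i with
  | inl p => Z p | inr (inl _) => False | inr (inr x) => ET x end.
pose xi (i : (H * H) + (H + H)) := match i with
  | inl p => p.1 | inr (inl x) => x | inr (inr x) => x end.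
pose psi (i : (H * H) + (H + H)) := match i with
  | inl p => p.2 | inr (inl x) => x | inr (inr x) => x end.
exists A, B, xi, psi; split.
- split.
  + by move=> [p /Zsing[[]]|[x /ES1[]|x []]].
  + by move=> [p /Zsing[_ []]|[x /ESn|x []]].
  + move=> [p|[x|x]] [q|[y|y]] //= An Ak nk.
    * by have [|//] := Zorth _ _ An Ak; move=> pq; apply: nk; rewrite pq.
    * by apply: dot_eq0C; apply: (ES1 _ Ak).2.
    * by apply: (ES1 _ An).2.
    * by apply: ESorth => // xy; apply: nk; rewrite xy.
  + move=> x Sx xA; apply: ESmax => //; first by move=> p Zp; exact: (xA (inl p)).
    by move=> y ESy; exact: (xA (inr (inl y))).
- split.
  + by move=> [p /Zsing[[]]|[x []|x /ET1[]]].
  + by move=> [p /Zsing[_ []]|[x []|x /ETn]].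
  + move=> [p|[x|x]] [q|[y|y]] //= An Ak nk.
    * by have [|//] := Zorth _ _ An Ak; move=> pq; apply: nk; rewrite pq.
    * by apply: dot_eq0C; apply: (ET1 _ Ak).2.
    * by apply: (ET1 _ An).2.
    * by apply: ETorth => // xy; apply: nk; rewrite xy.
  + move=> x Tx xB; apply: ETmax => //; first by move=> p Zp; exact: (xB (inl p)).
    by move=> y ETy; exact: (xB (inr (inr y))).
- move=> [p|[x|x]] [q|[y|y]] //= An Bk nk.
  + have [[Sp _] _ _ _ _] := Zsing _ An.
    have [_ _ PSq _ _] := Zsing _ Bk.
    rewrite -(dot_projr projS)// PSq dotZr.
    have [|-> _] := Zorth _ _ An Bk; first by move=> pq; apply: nk; rewrite pq.
    by rewrite mulr0.
  + by apply: T1S; [exact: ET1|case: (Zsing _ An) => -[]].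
  + by apply: S1T; [exact: ES1|case: (Zsing _ Bk) => -[]].
  + by apply: S1T; [exact: ES1|case: (ET1 _ Bk)].
apply/cvg0_cofiniteP => e e0.
have [_ /(_ [set t : H | `|t| <= 1])] := compactST.
have /[swap]/[apply] cX : bounded_set [set t : H | `|t| <= 1].
  by apply/bounded_setP; exists 1.
(* The vectors [PS p.2] are multiples of the orthonormal [p.1]; two of them with coefficients of
   modulus at least [e] are at distance at least [e]. *)
apply: (separated_finite (f := fun i => PS (psi i)) cX e0).
  move=> [p|[x|x]] [[//= Ap _] _]; have [[Sp Tp] [_ p2] _ _ _] := Zsing _ Ap.
  exists p.2; rewrite /= ?(proj_id closedT projT)//.
  by rewrite -(@ler_pXn2r _ 2)// ?nnegrE// dot_norm p2 expr1n.
move=> [p|[x|x]] [q|[y|y]] [[//= Ap _] pe] [[//= Aq _] qe] pq.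
have [_ [p1 _] PSp _ _] := Zsing _ Ap; have [_ [q1 _] PSq _ _] := Zsing _ Aq.
have [|pq1 _] := Zorth _ _ Ap Aq; first by move=> E; apply: pq; rewrite E.
rewrite -(@ler_pXn2r _ 2)// ?nnegrE ?(ltW e0)//.
rewrite PSp PSq (pythagoras dot_norm); last first.
  by rewrite -scaleNr dotZl dotZr pq1 !mulr0.
rewrite normrN !normrZ !exprMn !dot_norm p1 q1 !mulr1.
rewrite (@le_trans _ _ (`|dot p.2 p.1| ^+ 2))// ?lerDl ?exprn_ge0//.
by rewrite ler_pXn2r ?nnegrE ?(ltW e0)// dotC norm_conjC.
Qed.

End Singular.

(** * Relabelling by natural numbers in the separable case *)

Section Countable.
Variables (R : realType) (H : completeNormedModType R[i]).
Variables (dot : {dot H for @Num.conj R[i]}) (dot_norm : induces_norm dot).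

(** Distinct basis vectors are at distance at least 1, so points of the dense set within [2^-1] of
    them are distinct. *)
Lemma separable_basis_countable (S : set H) (I : Type) (A : set I) (xi : I -> H) :
  separable_set S -> orthonormal_basis dot S A xi -> countable A.
Proof.
move=> [D [countD _ SD]] [Sxi xi1 xi0 _].
have e0 : 0 < 2^-1 :> R[i] by rewrite invr_gt0.
have near_D n : exists d, A n -> D d /\ `|xi n - d| < 2^-1.
  have [An|nAn] := pselect (A n); last by exists 0.
  have [d Dd dn] := (closure_normP _ _).1 (SD _ (Sxi _ An)) _ e0.
  by exists d.
have [d dP] := choice near_D.
have [h hinj] := countable_injP _ countD.
apply/countable_injP; exists (h \o d) => n k /set_mem An /set_mem Ak /= hdn.
have [[Dn dn] [Dk dk]] := (dP _ An, dP _ Ak).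
have dnk : d n = d k by apply: hinj => //; exact: mem_set.
apply: contrapT => nk.
have : `|xi n - xi k| < 1.
  rewrite -(subrK (d n) (xi n)) -addrA (le_lt_trans (ler_normD _ _))//.
  by rewrite [ltRHS]splitr div1r ltrD// dnk distrC.
have : 1 <= `|xi n - xi k|.
  rewrite -(@ler_pXn2r _ 2)// ?nnegrE// expr1n (pythagoras dot_norm).
    by rewrite normrN !dot_norm !xi1// lerDl.
  by rewrite linearNr /= xi0// oppr0.
by move=> /le_lt_trans/[apply]; rewrite ltxx.
Qed.

Lemma has_diagonal_bases_nat (S T : set H) (I : Type) :
    separable_set S -> separable_set T ->
  has_diagonal_bases dot S T (@cofinite I) ->
  has_diagonal_bases dot S T (\oo : set_system nat).
Proof.
move=> sepS sepT [A [B [xi [psi [basis_xi basis_psi diag]]]]].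
rewrite eventually_cofinite => /cvg0_cofiniteP small.
have cA := separable_basis_countable sepS basis_xi.
have cB := separable_basis_countable sepT basis_psi.
(* A single injection on the union of [A] and [B] lets a common index keep a common label. *)
have [h hinj] : exists h : I -> nat, {in A `|` B &, injective h}.
  apply/countable_injP.
  have -> : A `|` B = \bigcup_(b in [set: bool]) (if b then A else B).
    apply/seteqP; split=> [i [Ai|Bi]|i [[] _ ?]]; [|by exists false|by left|by right].
    by exists true.
  by apply: bigcup_countable => // -[].
(* The value 0 at numbers that label nothing is a placeholder outside both new index sets. *)
pose push (e : I -> H) m :=
  if pselect (exists2 i, (A `|` B) i & h i = m) is left im
  then e (s2val (cid2 im)) else 0.
have pushE e i : (A `|` B) i -> push e (h i) = e i.
  move=> ABi; rewrite /push; case: pselect => [im|[]]; last by exists i.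
  congr e; apply: hinj; rewrite ?inE//; [exact: (s2valP (cid2 im))|].
  exact: (s2valP' (cid2 im)).
have inj i j : (A `|` B) i -> (A `|` B) j -> h i = h j -> i = j.
  by move=> ABi ABj; apply: hinj; exact: mem_set.
have push_basis V C e : C `<=` A `|` B -> orthonormal_basis dot V C e ->
    orthonormal_basis dot V (h @` C) (push e).
  move=> CAB [Ve e1 e0 e_complete]; split.
  - by move=> _ [i Ci <-]; rewrite pushE; [exact: Ve|exact: CAB].
  - by move=> _ [i Ci <-]; rewrite pushE; [exact: e1|exact: CAB].
  - move=> _ _ [i Ci <-] [j Cj <-] ij.
    by rewrite !pushE; [|exact: CAB|exact: CAB]; apply: e0 => // E; apply: ij; rewrite E.
  - move=> x Vx xe; apply: e_complete => // i Ci.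
    by rewrite -pushE; [apply: xe; exists i|exact: CAB].
exists (h @` A), (h @` B), (push xi), (push psi); split.
- by apply: push_basis => // i; left.
- by apply: push_basis => // i; right.
- move=> _ _ [i Ai <-] [j Bj <-] ij; rewrite !pushE; [|by right|by left].
  by apply: diag => // E; apply: ij; rewrite E.
apply/cvg0_cofiniteP => e e0.
apply: sub_finite_set (finite_image h (small e e0)) => _ [[[i Ai <-] [j Bj hji]] ei].
(* A number in both images labels one index, which lies in [A] and in [B]. *)
have ji : j = i by apply: inj; [right|left|].
rewrite ji in Bj; exists i => //; split=> //.
by rewrite !pushE in ei; [|left|left].
Qed.

End Countable.

(** * The equivalence for arbitrary index types, and for sequences in the separable case *)

Theorem theorem4p1 (R : realType) (H : completeNormedModType R[i])
    (dot : {dot H for @Num.conj R[i]}) (dot_norm : induces_norm dot)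
    (S T : set H) (closedS : closed_subspace S) (closedT : closed_subspace T)
    (PS PT : H -> H) (projS : orthogonal_projection dot S PS)
    (projT : orthogonal_projection dot T PT) :
  (compact_operator (PS \o PT) <->
     exists I : Type, has_diagonal_bases dot S T (@cofinite I)) /\
  (separable_set S -> separable_set T ->
     (compact_operator (PS \o PT) <->
        has_diagonal_bases dot S T (\oo : set_system nat))).
Proof.
have compactE : compact_operator (PS \o PT) <->
    exists I : Type, has_diagonal_bases dot S T (@cofinite I).
  split=> [compactST|[I [A [B [xi [psi [bxi bpsi diag]]]]]]].
    exact: (compact_has_diagonal_bases dot_norm closedS closedT projS projT).
  move=> /cvg0_cofiniteP small.
  (* [{classic I}] gives an arbitrary [I] the choice structure that finite index sets call for. *)
  apply: (compact_diagonal (I := {classic I}) dot_norm closedS closedT projS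
    projT bxi bpsi diag) => e e0.
  by apply: sub_finite_set (small e e0) => n [An Bn en].
split=> // sepS sepT; split.
  by move=> /compactE[I]; exact: has_diagonal_bases_nat.
by rewrite eventually_cofinite => bases; apply/compactE; exists nat.
Qed.
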